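(* Let $(X,Y,\langle\cdot,\cdot\rangle)$ be an asymmetric dual pair, with $X$ carrying $\sigma(X,Y)$ and $Y$ carrying $\sigma(Y,X)$. If $Y$ is separable, then every subset $S\subseteq X$ that is $T_1$ and countably compact (in the subspace topology) is compact and has a countable network.
   Context: All vector spaces and cones are over the reals; a cone is a commutative monoid $(Y,+,0)$ with a scalar multiplication by nonnegative reals satisfying the usual vector space axioms. An asymmetric dual pair $(X,Y,\langle\cdot,\cdot\rangle)$ consists of a vector space $X$, a cone $Y$ and a map $\langle\cdot,\cdot\rangle:X\times Y\to\mathbb R$ that is bilinear (with respect to nonnegative scalars in the second variable) and nondegenerate: $\langle x,\cdot\rangle=0$ implies $x=0$, and $\langle\cdot,y\rangle=\langle\cdot,z\rangle$ implies $y=z$. $\sigma(X,Y)$ is the topology on $X$ with basis the sets $\{x'\in X:\langle x'-x,y\rangle<\epsilon\ \forall y\in F\}$, with $x\in X$, $\epsilon>0$, $F\subseteq Y$ finite. $\sigma(Y,X)$ is the topology on $Y$ of pointwise convergence on $X$: $y_\alpha\to y$ iff $\langle x,y_\alpha\rangle\to\langle x,y\rangle$ for all $x\in X$. Topological spaces are not assumed Hausdorff. A set is compact (resp. countably compact) if every open cover (resp. countable open cover) has a finite subcover. A network of a topological space $Z$ is a collection $\mathcal M$ of subsets of $Z$ such that for every $z\in Z$ and every neighbourhood $U$ of $z$ there is $M\in\mathcal M$ with $z\in M\subseteq U$. *)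

(* Defs.v *)
From HB Require Import structures.
From mathcomp Require Import all_boot all_order all_algebra finmap.
From mathcomp Require Import all_classical all_reals all_analysis.

Set Implicit Arguments.
Unset Strict Implicit.
Unset Printing Implicit Defensive.

Import Order.TTheory GRing.Theory Num.Theory.
Import numFieldNormedType.Exports.
Local Open Scope classical_set_scope.
Local Open Scope ring_scope.

(* The semiring of nonnegative reals; a cone is a semimodule over it, that is,
   an [lSemiModType (nneg R)]. *)
Record nneg (R : realType) : Type :=
  Nneg { nneg_val :> R; nneg_valP : nneg_val \is Num.nneg }.

HB.instance Definition _ (R : realType) := [isSub for @nneg_val R].
HB.instance Definition _ (R : realType) := [Choice of nneg R by <:].
HB.instance Definition _ (R : realType) :=
  [SubChoice_isSubComNzSemiRing of nneg R by <:].

Record asymmetric_dual_pair (R : realType) (X : lmodType R)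
    (Y : lSemiModType (nneg R)) : Type := AsymmetricDualPair {
  pairing :> X -> Y -> R;
  pairingDl : forall x x' y, pairing (x + x') y = pairing x y + pairing x' y;
  pairingZl : forall (a : R) x y, pairing (a *: x) y = a * pairing x y;
  pairingDr : forall x y y', pairing x (y + y') = pairing x y + pairing x y';
  pairingZr : forall (a : nneg R) x y,
    pairing x (a *: y) = nneg_val a * pairing x y;
  pairing_nondegl : forall x, (forall y, pairing x y = 0) -> x = 0;
  pairing_nondegr : forall y z, (forall x, pairing x y = pairing x z) -> y = z
}.

(* Copies of [X] and [Y] that carry the topologies sigma(X, Y) and sigma(Y, X). *)
Definition sigmaX (R : realType) (X : lmodType R) (Y : lSemiModType (nneg R))
  (p : asymmetric_dual_pair X Y) : Type := X.
Definition sigmaY (R : realType) (X : lmodType R) (Y : lSemiModType (nneg R))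
  (p : asymmetric_dual_pair X Y) : Type := Y.

Section Topologies.
Context {R : realType} {X : lmodType R} {Y : lSemiModType (nneg R)}.
Variable p : asymmetric_dual_pair X Y.

Definition sigmaX_ball (x : X) (e : R) (F : {fset Y}) : set X :=
  [set x' | forall y, y \in F -> p (x' - x) y < e].

Definition sigmaX_base : set (set X) :=
  [set B | exists x e F, 0 < e /\ B = sigmaX_ball x e F].

Let pairing0l y : p 0 y = 0.
Proof. by rewrite -(scale0r 0) pairingZl mul0r. Qed.

Let sigmaX_ball_center (x : X) (e : R) (F : {fset Y}) :
  0 < e -> sigmaX_ball x e F x.
Proof. by move=> e0 y _; rewrite subrr pairing0l. Qed.

Let sigmaX_ball_sub (x : X) (e : R) (F : {fset Y}) (x0 : X) :
  0 < e -> sigmaX_ball x e F x0 ->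
  exists2 d : R, 0 < d & sigmaX_ball x0 d F `<=` sigmaX_ball x e F.
Proof.
move=> e0 x0B.
have key (s : seq Y) : (forall y, y \in s -> p (x0 - x) y < e) ->
    exists2 d : R, 0 < d & forall y, y \in s -> p (x0 - x) y + d <= e.
  elim: s => [|y s IH] yP; first by exists 1.
  have [|d d0 dP] := IH; first by move=> z zs; apply: yP; rewrite inE zs orbT.
  exists (Num.min d (e - p (x0 - x) y)).
    by rewrite lt_min d0 subr_gt0 yP// inE eqxx.
  move=> z; rewrite inE -lerBrDl ge_min => /orP[/eqP ->|/dP].
    by rewrite lexx orbT.
  by rewrite -lerBrDl => ->.
have [d d0 dP] := key F x0B.
exists d => // x' x'B y yF; apply: lt_le_trans (dP _ yF).
have -> : x' - x = (x0 - x) + (x' - x0) by rewrite [RHS]addrC subrKA.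
by rewrite pairingDl ltrD2l x'B.
Qed.

Let sigmaX_cover : \bigcup_(B in sigmaX_base) id B = setT.
Proof.
apply/seteqP; split=> // x _.
exists (sigmaX_ball x 1 fset0); first by exists x, 1, fset0; rewrite ltr01.
exact: sigmaX_ball_center.
Qed.

Let sigmaX_join (A B : set X) (x : X) : sigmaX_base A -> sigmaX_base B ->
  id A x -> id B x ->
  exists C, [/\ sigmaX_base C, id C x & id C `<=` id A `&` id B].
Proof.
move=> [x1 [e1 [F1 [e10 ->]]]] [x2 [e2 [F2 [e20 ->]]]] /= xA xB.
have [d1 d10 s1] := sigmaX_ball_sub e10 xA.
have [d2 d20 s2] := sigmaX_ball_sub e20 xB.
have d0 : 0 < Num.min d1 d2 by rewrite lt_min d10 d20.
exists (sigmaX_ball x (Num.min d1 d2) (F1 `|` F2)%fset); split.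
- by exists x, (Num.min d1 d2), (F1 `|` F2)%fset.
- exact: sigmaX_ball_center.
- move=> x' x'B; split; [apply: s1|apply: s2] => y yF.
    by have := x'B y; rewrite in_fsetU yF lt_min => /(_ isT) /andP[].
  by have := x'B y; rewrite in_fsetU yF orbT lt_min => /(_ isT) /andP[].
Qed.

HB.instance Definition _ := Choice.copy (sigmaX p) X.
HB.instance Definition _ :=
  isBaseTopological.Build (sigmaX p) sigmaX_cover sigmaX_join.

HB.instance Definition _ := Topological.copy (sigmaY p)
  (initial_topology ((fun y x => p x y) : Y -> {ptws X -> R})).

End Topologies.

Definition separable (T : topologicalType) : Prop :=
  exists2 D : set T, countable D & dense D.

Definition countably_compact (T : topologicalType) (A : set T) : Prop :=
  forall (D : set nat) (f : nat -> set T),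
    (forall i, D i -> open (f i)) -> A `<=` cover D f ->
    finite_subset_cover D f A.

Definition network (T : topologicalType) (M : set (set T)) : Prop :=
  forall (z : T) (U : set T), nbhs z U ->
    exists B : set T, [/\ M B, B z & B `<=` U].

Definition has_countable_network (T : topologicalType) : Prop :=
  exists2 M : set (set T), countable M & network M.

(* Main.v *)
Require Import Defs.
From mathcomp Require Import all_boot all_order all_algebra finmap.
From mathcomp Require Import all_classical all_reals all_analysis.

(** The sets [{x | <x, d> < q}], for [d] in a countable dense subset of [Y] and
    [q] rational, form a countable family of sigma(X, Y)-open sets. It need not
    generate the topology of [S], but it still separates the points of [S]
    asymmetrically: if [x != z] are points of the T1 space [S], a basic
    neighbourhood of [x] that misses [z] provides some [y] with
    [<z - x, y> > 0]; this is an open condition on [y], so some [d] of the dense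
    set satisfies [<x, d> < <z, d>], and a rational [q] in between yields a
    member of the family that contains [x] but not [z].

    The rest is general topology ([countable_separating_network] and
    [countable_network_compact]). In a countably compact space [T], let [U] be
    an open set around [z]. The members of the family that miss [z] cover the
    complement of [U], so finitely many of them do, and the complement of their
    union lies between [{z}] and [U]. Hence the complements of the finite unions
    of members of the family, of which there are countably many, form a network.
    Finally, every open cover of a space with a countable network has a countable
    subcover, which countable compactness makes finite. *)

Set Implicit Arguments.
Unset Strict Implicit.
Unset Printing Implicit Defensive.

Import Order.TTheory GRing.Theory Num.Theory.
Import numFieldNormedType.Exports.
Local Open Scope classical_set_scope.

Lemma countable_sub_range (T : Type) (A : set (set T)) :
  countable A -> exists W : nat -> set T, A `<=` range W.
Proof. by move=> /pcard_surjP[W AW]; exists W. Qed.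

(** The members of [B] that miss [z] cover the complement of any open set
    around [z]; complements of finite unions of members of [B] therefore
    squeeze between [z] and its neighbourhoods. *)
Lemma countable_separating_network (T : topologicalType) (B : set (set T)) :
  countable B -> B `<=` open ->
  (forall x z : T, x != z -> exists A, [/\ B A, A x & ~ A z]) ->
  countably_compact [set: T] -> has_countable_network T.
Proof.
move=> /countable_sub_range[W BW] Bopen sepB ccT.
exists (range (fun s : {fset nat} => ~` cover [set` s] W)).
  exact: sub_countable (card_image_le _ _) (countableP _).
move=> z U; rewrite nbhsE => -[V [Vopen Vz] VU].
(* Since [W] may also enumerate sets outside [B] or sets that contain [z],
   [f n] reduces to [V] at those indices; adding [V] at every index covers
   [z] without an extra index. *)
pose f n := V `|` [set x | [/\ B (W n), W n x & ~ W n z]].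
have fopen n : [set: nat] n -> open (f n).
  move=> _; apply: openU => //.
  have [[BW' Wz]|nBW] := pselect (B (W n) /\ ~ W n z).
    rewrite (_ : [set x | _] = W n); first exact: Bopen.
    by apply/seteqP; split=> x //= [].
  rewrite (_ : [set x | _] = set0); first exact: open0.
  by apply/seteqP; split=> x //= -[? _ ?]; apply: nBW.
have fcover : [set: T] `<=` cover [set: nat] f.
  move=> x _; have [->|/sepB[A [BA Ax Az]]] := eqVneq x z.
    by exists 0%N => //; left.
  have [n _ WnA] := BW _ BA.
  by exists n => //; right; rewrite /= WnA.
have [s _ scover] := ccT _ _ fopen fcover.
pose s' := [fset n in s | `[< ~ W n z >]]%fset.
exists (~` cover [set` s'] W); split.
- by exists s'.
- by move=> [n /=]; rewrite !inE /= => /andP[_ /asboolP].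
- move=> x nx; apply: VU; have [n ns [//|[_ Wnx Wnz]]] := scover x Logic.I.
  case: nx; exists n => //=; rewrite !inE /=.
  by apply/andP; split => //; apply/asboolP.
Qed.

(** Only countably many network sets lie inside members of a given cover;
    one member chosen for each of them still covers the space. *)
Lemma countable_network_compact (T : topologicalType) :
  has_countable_network T -> countably_compact [set: T] ->
  cover_compact [set: T].
Proof.
move=> [M /countable_sub_range[W MW] netM] ccT I D f fopen fcover.
have [D0|/set0P[i0 Di0]] := eqVneq D set0.
  by exists fset0%fset => // x /fcover [i]; rewrite D0.
pose N : set nat := [set n | exists2 i, D i & W n `<=` f i].
have /choice[h hP] : forall n, exists i, D i /\ (N n -> W n `<=` f i).
  move=> n; have [[i Di Wi]|nN] := pselect (N n); first by exists i.
  by exists i0.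
have [||s sN scover] := ccT N (f \o h).
- by move=> n _; apply: fopen; exact: (hP n).1.
- move=> x /fcover[i Di fix_].
  have [A [MA Ax Af]] := netM x (f i) (open_nbhs_nbhs (conj (fopen i Di) fix_)).
  have [n _ WnA] := MW _ MA.
  have Nn : N n by exists i => //; rewrite WnA.
  by exists n => //=; apply: (hP n).2 => //; rewrite WnA.
exists [fset h n | n in s]%fset.
  by move=> i /imfsetP[n _ ->]; rewrite inE; exact: (hP n).1.
move=> x /scover[n ns fx]; exists (h n) => //=.
by apply/imfsetP; exists n.
Qed.

Section AsymmetricDualPair.
Context {R : realType} {X : lmodType R} {Y : lSemiModType (nneg R)}.
Variable p : asymmetric_dual_pair X Y.
Local Open Scope ring_scope.

Lemma pairingBl (x z : X) (y : Y) : p (x - z) y = p x y - p z y.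
Proof. by rewrite -[in RHS](subrK z x) [in RHS]pairingDl addrK. Qed.

(** A basic ball around [w] that contains [x] but not [z] has a functional [y]
    at which [<x - w, y>] is below the radius while [<z - w, y>] is not. *)
Lemma sigmaX_open_pairing_lt (A : set (sigmaX p)) (x z : sigmaX p) :
  open A -> A x -> ~ A z -> exists y, p x y < p z y.
Proof.
move=> [Bs BsP <-] [B BsB Bx] nAz; have [w [e [F [e0 BE]]]] := BsP _ BsB.
apply: contrapT => nlt; apply: nAz; exists B => //.
move: Bx; rewrite /= BE => Bx y yF; apply: le_lt_trans (Bx y yF).
by rewrite !pairingBl lerB// leNgt; apply/negP => xz; apply: nlt; exists y.
Qed.

Lemma open_pairing_lt (y : Y) (c : R) :
  open ([set x | p x y < c] : set (sigmaX p)).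
Proof.
exists [set B | sigmaX_base p B /\ B `<=` [set x | p x y < c]].
  by move=> B [].
apply/seteqP; split=> [x [B [_ sB] /sB]//|x /= xc].
exists (sigmaX_ball p x (c - p x y) [fset y]%fset).
  split; first by exists x, (c - p x y), [fset y]%fset; rewrite subr_gt0.
  by move=> x' /(_ y); rewrite inE eqxx pairingBl ltrD2r; apply.
by move=> y'; rewrite inE => /eqP ->; rewrite pairingBl ltrD2r.
Qed.

Lemma open_pairing_gt (x : X) (c : R) :
  open ([set y | c < p x y] : set (sigmaY p)).
Proof.
exists [set f : {ptws X -> R} | c < f x] => //.
apply: (@open_comp _ _ (fun f : {ptws X -> R} => f x) [set r | c < r]).
  by move=> f _; exact: proj_continuous.
exact: open_gt.
Qed.

(** The T1 axiom yields some [y] with [<z - x, y> > 0], and this condition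
    on [y] is open, so it is met inside the dense set. *)
Lemma accessible_dense_pairing_lt (D : set (sigmaY p)) (S : set (sigmaX p)) :
  dense D -> accessible_space (set_type S) ->
  forall x z : set_type S, x != z ->
  exists2 d, D d & p (set_val x) d < p (set_val z) d.
Proof.
move=> Ddense T1 x z /T1[_ [[A Aopen <-]]]; rewrite !inE /= => Ax Az.
have [y xz] := sigmaX_open_pairing_lt Aopen Ax Az.
have [|d []] := Ddense _ _ (open_pairing_gt (set_val z - set_val x) 0).
  by exists y; rewrite /= pairingBl subr_gt0.
by rewrite /= pairingBl subr_gt0 => xzd Dd; exists d.
Qed.

End AsymmetricDualPair.

Theorem theorem4p4 (R : realType) (X : lmodType R) (Y : lSemiModType (nneg R))
    (p : asymmetric_dual_pair X Y) :
  separable (sigmaY p) ->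
  forall S : set (sigmaX p),
    accessible_space (set_type S) ->
    countably_compact [set: set_type S] ->
    cover_compact [set: set_type S] /\ has_countable_network (set_type S).
Proof.
move=> [D Dcount Ddense] S T1 ccS.
have net : has_countable_network (set_type S).
  pose halfspace (dq : Y * rat) : set (set_type S) :=
    [set x | (p (set_val x) dq.1 < ratr dq.2)%R].
  pose B := halfspace @` (D `*` [set: rat]).
  have Bcount : countable B.
    apply: sub_countable (card_image_le _ _) _.
    exact: countableX Dcount (countableP _).
  apply: (countable_separating_network Bcount) => //.
    move=> _ [[d q] _ <-].
    by exists [set x | (p x d < ratr q)%R] => //; exact: open_pairing_lt.
  move=> x z /(accessible_dense_pairing_lt Ddense T1)[d Dd].
  move=> /rat_in_itvoo[q]; rewrite in_itv /= => /andP[xq qz].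
  exists (halfspace (d, q)); split => //; first by exists (d, q).
  by move=> /(lt_trans qz); rewrite ltxx.
by split=> //; exact: countable_network_compact.
Qed.
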